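(* Let $K$ be a (not necessarily commutative) field, let $U\neq\{0\}$ be a left vector space over $K$ of arbitrary (possibly infinite) dimension, let $\varphi:K\to\mathrm{End}_K(U)$, $k\mapsto\rho_k$, be a representation (ring homomorphism preserving $1$), and let $\Phi$ be the associated projective representation of the projective line $\mathbb{P}(K)$ over $K$ in the projective space $\mathbb{P}(K,U\times U)$. Then the following are equivalent: (a) $\mathbb{P}(K)^\Phi$ is a regulus. (b) Any two transversals of $\mathbb{P}(K)^\Phi$ are projectively linked, and all transversals of $\mathbb{P}(K)^\Phi$ together generate $\mathbb{P}(K,U\times U)$. (c) There exist a basis $(b_i)_{i\in I}$ of $U$ and an automorphism $\alpha\in\mathrm{Aut}(K)$ such that for all $k\in K$ the mapping $\rho_k=k^\varphi\in\mathrm{End}_K(U)$ is the $K$-linear mapping given by $b_i\mapsto k^\alpha b_i$ ($i\in I$).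
   Context: Conventions: ''field'' means a division ring, not necessarily commutative; ring homomorphisms preserve $1$. Endomorphisms act on the right, written exponentially, and are composed from left to right; so $\varphi$ turns $U$ into a $(K,K)$-bimodule via $u\cdot k:=u^{\rho_k}$. $\mathbb{P}(K,U\times U)$ is the projective space of subspaces of the left $K$-vector space $U\times U$; its points (lines) are the $1$-dimensional ($2$-dimensional) subspaces. $\mathbb{P}(K)$ is the set of $1$-dimensional subspaces $K(k,l)$ of the left vector space $K^2$. The projective representation associated to $\varphi$ is the mapping $\Phi$ with $K(k,l)^\Phi=\{(u\cdot k,u\cdot l)\mid u\in U\}$, a subspace of $U\times U$ isomorphic to one of its complements. $\mathbb{P}(K)^\Phi$ is the set of all these subspaces; they are pairwise complementary. A line $T$ of $\mathbb{P}(K,U\times U)$ is a transversal of $\mathbb{P}(K)^\Phi$ if $T$ meets each element of $\mathbb{P}(K)^\Phi$ in a unique point and each point of $T$ lies on an element of $\mathbb{P}(K)^\Phi$ (which is then unique). For two transversals $T_1,T_2$ of $\mathbb{P}(K)^\Phi$ define the mapping $\pi_{12}:T_1\to T_2$ between their point sets by $T_1\cap p^\Phi\mapsto T_2\cap p^\Phi$ for $p\in\mathbb{P}(K)$. $T_1$ and $T_2$ are projectively linked if $\pi_{12}$ is a projectivity, i.e. induced by a $K$-linear bijection of the $2$-dimensional subspace $T_1$ onto $T_2$. Regulus: given a basis $(b_i)_{i\in I}$ of $U$, the set of all subspaces $$\Big\{\Big(\sum_{i\in I}x_ikb_i,\ \sum_{i\in I}x_ilb_i\Big)\ \Big|\ x_i\in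 K,\ \text{almost all } x_i=0\Big\},\qquad K(k,l)\in\mathbb{P}(K),$$ is a regulus in $\mathbb{P}(K,U\times U)$, and the reguli in $\mathbb{P}(K,U\times U)$ are exactly the sets of subspaces that are projectively equivalent to it, i.e. its images under $K$-linear automorphisms of $U\times U$. *)

(* Defs.v *)
From mathcomp Require Import all_boot all_order all_algebra.
From mathcomp Require Import all_classical.

Set Implicit Arguments.
Unset Strict Implicit.
Unset Printing Implicit Defensive.

Import GRing.Theory.
Local Open Scope classical_set_scope.
Local Open Scope ring_scope.

Section LinearAlgebra.
Variables (K : unitRingType) (V : lmodType K).

Definition finsupp (I : choiceType) : set (I -> K) :=
  [set x | finite_set [set i | x i != 0]].

(* By convention the sum is 0 when infinitely many terms are nonzero, so
   [lincomb] is only used with coefficients in [finsupp]. *)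
Definition lincomb (I : choiceType) (b : I -> V) (x : I -> K) : V :=
  \sum_(i \in [set: I]) x i *: b i.

Definition is_basis (I : choiceType) (b : I -> V) (W : set V) : Prop :=
  [set lincomb b x | x in @finsupp I] = W /\
  (forall x, finsupp x -> lincomb b x = 0 -> forall i, x i = 0).

Definition has_dim (n : nat) (W : set V) : Prop :=
  exists b : 'I_n -> V, is_basis b W.

Definition is_point (P : set V) : Prop := has_dim 1 P.
Definition is_line (T : set V) : Prop := has_dim 2 T.

Definition is_subspace (W : set V) : Prop := submod_closed [in W].

Definition generated_subspace (X : set V) : set V := smallest is_subspace X.

Definition linear_bijection_on (f : V -> V) (S T : set V) : Prop :=
  set_bij S T f /\
  (forall a u v, S u -> S v -> f (a *: u + v) = a *: f u + f v).

End LinearAlgebra.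

Section ProjectiveRepresentation.
Variable K : unitRingType.

(* The subspace K(k,l) of the left vector space K^2. *)
Definition kpt (k l : K) : set (K^o * K^o) :=
  [set ((a * k, a * l) : K^o * K^o) | a in [set: K]].

Definition proj_line : set (set (K^o * K^o)) := [set p | is_point p].

Variable U : lmodType K.

(* Endomorphisms act on the right and are composed from left to right, so the
   product k * l acts as "first [rho k], then [rho l]". *)
Definition is_representation (rho : K -> {linear U -> U}) : Prop :=
  [/\ forall u, rho 1 u = u,
      forall k l u, rho (k + l) u = rho k u + rho l u &
      forall k l u, rho (k * l) u = rho l (rho k u)].

Variable rho : K -> {linear U -> U}.

(* All coordinate pairs (k,l) in p are used at once; [PhiE] shows that any
   single generating pair gives the same subspace. *)
Definition Phi (p : set (K^o * K^o)) : set (U * U) :=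
  \bigcup_(x in p) [set (rho x.1 u, rho x.2 u) | u in [set: U]].

Lemma PhiE (k l : K) : is_representation rho ->
  Phi (kpt k l) = [set (rho k u, rho l u) | u in [set: U]].
Proof.
move=> [rho1 _ rhoM]; apply/seteqP; split=> w /=.
  by move=> [_ [a _ <-] [u _ <-]]; exists (rho a u); rewrite //= !rhoM.
by move=> [u _ <-]; exists (k, l); [exists 1; rewrite ?mul1r | exists u].
Qed.

Definition Phi_image : set (set (U * U)) := [set Phi p | p in proj_line].

Definition transversal_line (T : set (U * U)) : Prop :=
  [/\ is_line T,
      forall S, Phi_image S -> exists! P, is_point P /\ P `<=` T `&` S &
      forall P, is_point P -> P `<=` T -> exists2 S, Phi_image S & P `<=` S].

(* The graph of the mapping pi_12 between the point sets of [T1] and [T2]. *)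
Definition link_map (T1 T2 P Q : set (U * U)) : Prop :=
  exists2 p, proj_line p & P = T1 `&` Phi p /\ Q = T2 `&` Phi p.

Definition projectively_linked (T1 T2 : set (U * U)) : Prop :=
  exists2 f, linear_bijection_on f T1 T2 &
    forall P Q, link_map T1 T2 P Q -> f @` P = Q.

Definition std_regulus (I : choiceType) (b : I -> U) : set (set (U * U)) :=
  [set S | exists k l : K, proj_line (kpt k l) /\
     S = [set (lincomb b (fun i => x i * k), lincomb b (fun i => x i * l))
         | x in @finsupp K I]].

Definition is_regulus (R : set (set (U * U))) : Prop :=
  exists (I : choiceType) (b : I -> U), is_basis b [set: U] /\
  exists g : {linear (U * U)%type -> (U * U)%type}, bijective g /\
    R = [set g @` S | S in std_regulus b].

End ProjectiveRepresentation.

(* Main.v *)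
Require Import Defs.
From HB Require Import structures.
From mathcomp Require Import all_boot all_order all_algebra.
From mathcomp Require Import all_classical.
Import GRing.Theory.
Local Open Scope classical_set_scope.
Local Open Scope ring_scope.

(* A transversal of the projective line given by a representation [rho] is a
   line {(a z, c z)} where z is a common eigenvector, rho_l z = beta(l) z, with
   surjective eigenvalue map beta; conversely any such z gives a transversal.

   (a) => (b): the standard regulus of a basis b is the projective line of the
   representation sigma_l : b_i |-> l b_i.  Comparing a nonzero coordinate shows
   that each of its common eigenvectors z can be rescaled so that beta is the
   identity, so (a z1, c z1) |-> (a z2, c z2) links any two transversals.  The
   b_i themselves yield generating transversals, and a linear automorphism of
   U x U carries all this over to an arbitrary regulus.

   (b) => (c): transversals with eigenvalue maps beta1 and beta2 are linked
   only if beta1 and beta2 are conjugate, so after rescaling all transversals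
   come from eigenvectors with one and the same map alpha.  These vectors span
   U, hence contain a basis.

   (c) => (a): the automorphism alpha only permutes the members of the regulus
   of the basis b. *)

Set Implicit Arguments.
Unset Strict Implicit.

(** * Linear combinations and coordinates *)

Section Lincomb.
Variable K : unitRingType.

(** Replaces finiteness of the support by an explicit duplicate-free list, possibly larger than the
    support. Two families can then share one list, and their [lincomb]s become ordinary sums over
    it. *)
Lemma finsuppP (I : choiceType) (x : I -> K) :
  finsupp x <-> exists2 r : seq I, uniq r & forall i, i \notin r -> x i = 0.
Proof.
split=> [fx|[r _ rx]].
  exists (finmap.enum_fset (fset_set [set i | x i != 0])); first exact: finmap.fset_uniq.
  by move=> i; rewrite in_fset_set // notin_setE /= => /negP; rewrite negbK => /eqP.
apply: sub_finite_set (finite_seq r) => i /=.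
by apply: contra_neqT => /rx.
Qed.

Lemma finsupp2 (I : choiceType) (x y : I -> K) : finsupp x -> finsupp y ->
  exists r : seq I, [/\ uniq r, forall i, i \notin r -> x i = 0 &
                        forall i, i \notin r -> y i = 0].
Proof.
move=> /finsuppP[r _ rx] /finsuppP[s _ sy]; exists (undup (r ++ s)).
by split=> [|i|i]; rewrite ?undup_uniq // mem_undup mem_cat negb_or
  => /andP[ri si]; rewrite ?rx ?sy.
Qed.

Lemma finsuppD (I : choiceType) (x y : I -> K) : finsupp x -> finsupp y ->
  finsupp (fun i => x i + y i).
Proof.
move=> /finsupp2 /[apply] -[r [ur rx ry]]; apply/finsuppP; exists r => // i ri.
by rewrite rx ?ry ?addr0.
Qed.

Lemma finsuppZ (I : choiceType) a (x : I -> K) : finsupp x ->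
  finsupp (fun i => a * x i).
Proof.
move=> /finsuppP[r ur rx]; apply/finsuppP; exists r => // i ri.
by rewrite rx ?mulr0.
Qed.

Lemma finsuppMr (I : choiceType) a (x : I -> K) : finsupp x ->
  finsupp (fun i => x i * a).
Proof.
move=> /finsuppP[r ur rx]; apply/finsuppP; exists r => // i ri.
by rewrite rx ?mul0r.
Qed.

Lemma finsupp_delta (I : choiceType) (i : I) : finsupp (fun j => (j == i)%:R : K).
Proof. by apply/finsuppP; exists [:: i] => // j; rewrite inE => /negPf ->. Qed.

Variable V : lmodType K.

Lemma lincomb_seq (I : choiceType) (b : I -> V) (x : I -> K) (r : seq I) :
  uniq r -> (forall i, i \notin r -> x i = 0) ->
  lincomb b x = \sum_(i <- r) x i *: b i.
Proof.
move=> ur rx; rewrite /lincomb (fsbigE r) //; last by move=> i _ /rx ->; rewrite scale0r.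
by apply: eq_bigl => i; rewrite in_setT.
Qed.

Lemma lincomb_ord n (b : 'I_n -> V) (x : 'I_n -> K) :
  lincomb b x = \sum_i x i *: b i.
Proof. by apply: lincomb_seq; rewrite ?index_enum_uniq // => i; rewrite mem_index_enum. Qed.

Lemma lincombD (I : choiceType) (b : I -> V) (x y : I -> K) :
  finsupp x -> finsupp y ->
  lincomb b (fun i => x i + y i) = lincomb b x + lincomb b y.
Proof.
move=> /finsupp2 /[apply] -[r [ur rx ry]].
rewrite !(lincomb_seq _ ur) //; last by move=> i ri; rewrite rx ?ry ?addr0.
by rewrite -big_split; apply: eq_bigr => i _; rewrite scalerDl.
Qed.

Lemma lincombZ (I : choiceType) (b : I -> V) a (x : I -> K) : finsupp x ->
  lincomb b (fun i => a * x i) = a *: lincomb b x.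
Proof.
move=> /finsuppP[r ur rx].
rewrite !(lincomb_seq _ ur) //; last by move=> i ri; rewrite rx ?mulr0.
by rewrite scaler_sumr; apply: eq_bigr => i _; rewrite scalerA.
Qed.

Lemma lincomb_delta (I : choiceType) (b : I -> V) (i : I) :
  lincomb b (fun j => (j == i)%:R) = b i.
Proof.
rewrite (@lincomb_seq _ _ _ [:: i]) //; last by move=> j; rewrite inE => /negPf ->.
by rewrite big_seq1 eqxx scale1r.
Qed.

End Lincomb.

Lemma lincomb_ord2 (K : unitRingType) (V : lmodType K) (b : 'I_2 -> V) (x : 'I_2 -> K) :
  lincomb b x = x 0 *: b 0 + x 1 *: b 1.
Proof.
by rewrite lincomb_ord big_ord_recl big_ord1 (_ : lift ord0 ord0 = 1) //; exact: val_inj.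
Qed.

Lemma linear_lincomb (K : unitRingType) (V W : lmodType K) (f : {linear V -> W})
  (I : choiceType) (b : I -> V) (x : I -> K) : finsupp x ->
  f (lincomb b x) = lincomb (f \o b) x.
Proof.
move=> /finsuppP[r ur rx]; rewrite !(lincomb_seq _ ur rx) linear_sum.
by apply: eq_bigr => i _; rewrite linearZ.
Qed.

Section Coordinates.
Variables (K : unitRingType) (V : lmodType K).
Variables (I : choiceType) (b : I -> V).
Hypothesis b_basis : is_basis b [set: V].

Lemma coord_exists (u : V) : {x : I -> K | finsupp x & lincomb b x = u}.
Proof.
suff: exists2 x, finsupp x & lincomb b x = u by exact: cid2.
by have : [set: V] u by []; rewrite -(proj1 b_basis).
Qed.

Definition coords (u : V) : I -> K := s2val (coord_exists u).

Lemma finsupp_coords u : finsupp (coords u).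
Proof. exact: s2valP. Qed.

Lemma lincomb_coords u : lincomb b (coords u) = u.
Proof. by rewrite /coords; case: coord_exists. Qed.

Lemma coordsK x : finsupp x -> coords (lincomb b x) = x.
Proof.
(* The factor [-1] brings the negated coordinates into the form covered by [finsuppZ] and
   [lincombZ]; the family [x i + y i] is then a relation among the [b i]. *)
move=> fx; pose y i := -1 * coords (lincomb b x) i.
have fy : finsupp y by exact: finsuppZ (finsupp_coords _).
apply: funext => i; apply/esym/eqP; rewrite -subr_eq0 -mulN1r; apply/eqP.
apply: (proj2 b_basis (fun i => x i + y i)); first exact: finsuppD.
by rewrite lincombD // lincombZ ?lincomb_coords ?scaleN1r ?subrr //;
  exact: finsupp_coords.
Qed.

End Coordinates.

(** * Points and lines over a division ring *)

Section Lines.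
Variable K : unitRingType.
Hypothesis K_field : forall x : K, x != 0 -> x \is a GRing.unit.

Lemma divring_scaler_eq0 (V : lmodType K) (a : K) (v : V) :
  a *: v = 0 -> v != 0 -> a = 0.
Proof.
move=> av v0; apply/eqP; apply: contraNT v0 => /K_field ua.
by rewrite -[v]scale1r -(mulVr ua) -scalerA av scaler0.
Qed.

Lemma divring_scalerI (V : lmodType K) (a c : K) (v : V) :
  v != 0 -> a *: v = c *: v -> a = c.
Proof.
move=> v0 /eqP; rewrite -subr_eq0 -scalerBl => /eqP /divring_scaler_eq0.
by move=> /(_ v0) /eqP; rewrite subr_eq0 => /eqP.
Qed.

Lemma divring_scaler_neq0 (V : lmodType K) (a : K) (v : V) :
  a != 0 -> v != 0 -> a *: v != 0.
Proof. by move=> a0 v0; apply: contra_neq a0 => /divring_scaler_eq0; exact. Qed.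

Lemma is_pointP (V : lmodType K) (P : set V) :
  is_point P <-> exists2 v, v != 0 & P = [set a *: v | a in [set: K]].
Proof.
split=> [[b [<- ind]]|[v v0 ->]].
  exists (b ord0).
    apply/eqP => b0; have := ind (fun=> 1) finite_finset.
    by rewrite lincomb_ord big_ord1 b0 scaler0 => /(_ erefl ord0)/eqP; rewrite oner_eq0.
  apply/seteqP; split=> w /= [].
    by move=> x _ <-; exists (x ord0); rewrite // lincomb_ord big_ord1.
  move=> a _ <-; exists (fun=> a); rewrite ?lincomb_ord ?big_ord1 //.
  exact: finite_finset.
exists (fun=> v); split.
  apply/seteqP; split=> w /= [].
    by move=> x _ <-; exists (x ord0); rewrite // lincomb_ord big_ord1.
  move=> a _ <-; exists (fun=> a); rewrite ?lincomb_ord ?big_ord1 //.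
  exact: finite_finset.
move=> x _; rewrite lincomb_ord big_ord1 => xv i; rewrite ord1.
exact: divring_scaler_eq0 xv v0.
Qed.

Definition span2 (V : lmodType K) (v w : V) : set V :=
  [set u | exists a c, u = a *: v + c *: w].

Definition free2 (V : lmodType K) (v w : V) : Prop :=
  forall a c, a *: v + c *: w = 0 -> a = 0 /\ c = 0.

Lemma is_lineP (V : lmodType K) (T : set V) :
  is_line T <-> exists v w, free2 v w /\ T = span2 v w.
Proof.
pose pr (a c : K) (i : 'I_2) := if i == 0 then a else c.
split=> [[b [<- ind]]|[v [w [vw ->]]]].
  exists (b 0), (b 1); split.
    move=> a c ac; have h := ind (pr a c) finite_finset.
    have {}h i : pr a c i = 0 by apply: h; rewrite lincomb_ord2.
    by split; [have := h 0 | have := h 1].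
  apply/seteqP; split=> u /= [].
    by move=> x _ <-; exists (x 0), (x 1); rewrite lincomb_ord2.
  move=> a [c ->]; exists (pr a c); first exact: finite_finset.
  by rewrite lincomb_ord2.
exists (fun i => if i == 0 then v else w); split.
  apply/seteqP; split=> u /= [].
    by move=> x _ <-; rewrite lincomb_ord2 /=; do 2 eexists.
  move=> a [c ->]; exists (pr a c); first exact: finite_finset.
  by rewrite lincomb_ord2.
move=> x _; rewrite lincomb_ord2 /= => /vw[x0 x1] i.
have [->//|i0] := eqVneq i 0; rewrite -x1; congr x; apply/val_inj => /=.
by case: i i0 => [[|[|//]] ?].
Qed.

Lemma span2_sub (V : lmodType K) (v w e f : V) :
  span2 v w e -> span2 v w f -> span2 e f `<=` span2 v w.
Proof.
move=> [a [c ->]] [a' [c' ->]] u [x [y ->]].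
exists (x * a + y * a'), (x * c + y * c').
by rewrite !scalerDr !scalerA !scalerDl addrACA.
Qed.

Lemma span2_mem (V : lmodType K) (v w : V) : span2 v w v /\ span2 v w w.
Proof.
split; first by exists 1, 0; rewrite scale1r scale0r addr0.
by exists 0, 1; rewrite scale1r scale0r add0r.
Qed.

Lemma span2C (V : lmodType K) (v w : V) : span2 v w = span2 w v.
Proof.
by apply/seteqP; split=> u [a [c ->]]; exists c, a; rewrite addrC.
Qed.

Lemma span2_exchange1 (V : lmodType K) (v w e : V) a c : a != 0 ->
  e = a *: v + c *: w -> span2 v w = span2 e w.
Proof.
move=> a0 eE; have ua := K_field a0.
apply/seteqP; split; apply: span2_sub; try exact: (proj2 (span2_mem _ _)).
  exists a^-1, (- (a^-1 * c)).
  by rewrite eE scalerDr !scalerA mulVr // scale1r scaleNr addrK.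
by exists a, c.
Qed.

(** Steinitz exchange in dimension two: first [e] replaces one of [v], [w], then [f] replaces the
    other. *)
Lemma span2_exchange (V : lmodType K) (v w e f : V) :
  span2 v w e -> span2 v w f -> free2 e f -> span2 v w = span2 e f.
Proof.
move=> [a [c eE]] f_in ef.
have e0 : e != 0.
  apply/eqP => e0; have [] := ef 1 0; first by rewrite e0 scaler0 scale0r addr0.
  by move/eqP; rewrite oner_eq0.
(* Since [e] is nonzero, one of its two coefficients is nonzero; swapping [v] and [w] makes it the
   first. *)
wlog a0 : v w a c eE f_in / a != 0.
  move=> W; have [a0|a0] := eqVneq a 0; last exact: (W v w a c).
  rewrite span2C; apply: (W w v c a); rewrite 1?span2C 1?addrC //.
  by apply: contraNneq e0 => c0; rewrite eE a0 c0 !scale0r addr0.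
have vwE := span2_exchange1 a0 eE.
move: f_in; rewrite vwE => -[x [y fE]].
(* Otherwise [f] would be the multiple [x *: e], against the independence of [e] and [f]. *)
have y0 : y != 0.
  apply/eqP => y0; have [] := ef x (-1).
    by rewrite fE y0 scale0r addr0 scaleN1r subrr.
  by move=> _ /eqP; rewrite oppr_eq0 oner_eq0.
rewrite [LHS]span2C [RHS]span2C.
by apply: (@span2_exchange1 _ w e f y x y0); rewrite fE addrC.
Qed.

Lemma point_sub_eq (V : lmodType K) (P Q : set V) :
  is_point P -> is_point Q -> P `<=` Q -> P = Q.
Proof.
move=> /is_pointP[v v0 ->] /is_pointP[w _ ->] sPQ.
apply/seteqP; split=> // u [a _ <-].
have [c _ cv] : [set a *: w | a in setT] v by apply: sPQ; exists 1; rewrite ?scale1r.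
have uc : c \is a GRing.unit.
  by apply: K_field; apply: contraNneq v0 => c0; rewrite -cv c0 scale0r.
by exists (a * c^-1) => //; rewrite -cv scalerA -mulrA mulVr // mulr1.
Qed.

End Lines.

(** * Bases inside a spanning set *)

Section ExtractBasis.
Variable K : unitRingType.
Hypothesis K_field : forall x : K, x != 0 -> x \is a GRing.unit.
Variable U : lmodType K.

(** Phrased with finite lists and coefficient functions on all of [U], so that no index type varies
    with [B] along the chains of Zorn's lemma. *)
Definition independent (B : set U) : Prop :=
  forall (r : seq U) (c : U -> K), uniq r -> [set` r] `<=` B ->
    \sum_(v <- r) c v *: v = 0 -> forall v, v \in r -> c v = 0.

Lemma subspaceP (V : lmodType K) (W : set V) :
  is_subspace W <-> W 0 /\ forall a u v, W u -> W v -> W (a *: u + v).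
Proof.
split=> -[W0 Wl]; split; first exact: set_mem W0.
- by move=> a u v Wu Wv; apply/set_mem/Wl; apply/mem_set.
- exact/mem_set.
- by move=> a u v /set_mem Wu /set_mem Wv; apply/mem_set/Wl.
Qed.

Lemma subspaceZ (V : lmodType K) (W : set V) a v : is_subspace W -> W v -> W (a *: v).
Proof. by move=> /subspaceP[W0 Wl] Wv; rewrite -[_ *: _]addr0; apply: Wl. Qed.

Lemma subspace_sum (W : set U) (r : seq U) (c : U -> K) :
  is_subspace W -> [set` r] `<=` W -> W (\sum_(v <- r) c v *: v).
Proof.
move=> /subspaceP[W0 Wl]; elim: r => [_|v r IH rW]; first by rewrite big_nil.
rewrite big_cons; apply: Wl; first by apply: rW; rewrite /= mem_head.
by apply: IH => w wr; apply: rW; rewrite /= inE [w \in r]wr orbT.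
Qed.

Lemma span_subspace (I : choiceType) (b : I -> U) :
  is_subspace [set lincomb b x | x in @finsupp K I].
Proof.
apply/subspaceP; split=> [|a _ _ [x fx <-] [y fy <-]].
  exists (fun i => 0); first by apply/finsuppP; exists [::].
  by rewrite (@lincomb_seq _ _ _ _ _ [::]) ?big_nil.
by exists (fun i => a * x i + y i); rewrite ?lincombD ?lincombZ //;
  do ?[apply: finsuppD | apply: finsuppZ].
Qed.

(** A relation involves only finitely many vectors, and these already lie in a single member of the
    chain. *)
Lemma independent_bigcup (F : set (set U)) :
  F `<=` independent -> total_on F subset -> independent (\bigcup_(X in F) X).
Proof.
(* The empty list is treated apart: if [F] is empty, no member of [F] contains it. *)
move=> Find Ftot [//|v0 r0] c; set r := v0 :: r0 => ur rF.
suff [X FX rX] : exists2 X, F X & [set` r] `<=` X by exact: Find FX r c ur rX.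
move: rF; rewrite {ur}/r {r}; elim: r0 v0 => [|w r IH] v rF.
  have [X FX Xv] : (\bigcup_(X in F) X) v by apply: rF; rewrite /= mem_head.
  by exists X => // u /=; rewrite inE => /eqP ->.
have [X FX Xv] : (\bigcup_(X in F) X) v by apply: rF; rewrite /= mem_head.
have [|Y FY rY] := IH w; first by move=> u ur; apply: rF; rewrite /= inE [u \in _]ur orbT.
have [XY|YX] := Ftot _ _ FX FY.
  by exists Y => // u /=; rewrite inE => /orP[/eqP ->|/rY //]; apply: XY.
by exists X => // u /=; rewrite inE => /orP[/eqP -> //|/rY /YX].
Qed.

Lemma independent_setU1 (B W : set U) s : independent B -> is_subspace W ->
  B `<=` W -> ~ W s -> independent (s |` B).
Proof.
move=> Bind Wsub BW nWs r c ur rB c0.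
have cB (q : seq U) : uniq q -> [set` q] `<=` s |` B -> s \notin q ->
    [set` q] `<=` B.
  by move=> uq qB sq v vq; have [vs|//] := qB v vq; move: sq; rewrite -vs => /negP[].
have [sr|sr] := boolP (s \in r); last exact: Bind (cB _ ur rB sr) c0.
have rsB : [set` rem s r] `<=` B.
  apply: cB; [exact: rem_uniq | by move=> v /mem_rem/rB | by rewrite mem_rem_uniq // !inE eqxx].
move: c0; rewrite (perm_big _ (perm_to_rem sr)) big_cons /= => c0.
(* With an invertible coefficient the relation could be solved for [s], which would put [s] into
   [W]. *)
have cs0 : c s = 0.
  apply/eqP; apply: contra_notT nWs => /K_field us.
  have /(subspaceZ (- (c s)^-1) Wsub) := subspace_sum c Wsub (subset_trans rsB BW).
  have -> : \sum_(v <- rem s r) c v *: v = - (c s *: s).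
    by apply/eqP; rewrite -addr_eq0 addrC c0.
  by rewrite scalerN scaleNr opprK scalerA mulVr // scale1r.
rewrite cs0 scale0r add0r in c0.
move=> v; rewrite (perm_mem (perm_to_rem sr)) inE => /orP[/eqP -> //|].
exact: Bind (rem_uniq s ur) rsB c0 v.
Qed.

Lemma independent_basis (B : set U) :
  independent B -> forall x : set_type B -> K, finsupp x ->
    lincomb (fun i : set_type B => val i) x = 0 -> forall i, x i = 0.
Proof.
move=> Bind x /finsuppP[r ur rx]; rewrite (lincomb_seq _ ur rx) => x0 i.
have [ir|/rx //] := boolP (i \in r).
(* Extends [x] from the subtype to all of [U], with value 0 outside [B]. *)
pose c v := oapp x 0 (insub v : option (set_type B)).
have cE (j : set_type B) : c (val j) = x j by rewrite /c valK.
rewrite -cE; apply: (Bind [seq val j | j <- r]).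
- by rewrite map_inj_uniq //; exact: val_inj.
- by move=> _ /mapP[j _ ->]; exact: set_valP.
- by rewrite big_map -[RHS]x0; apply: eq_bigr => j _; rewrite cE.
- exact: map_f.
Qed.

(** Zorn's lemma gives a maximal independent subset [B] of [S]. A vector of [S] outside the span of
    [B] could be adjoined to [B], so this span contains [S] and is all of [U]. *)
Lemma spanning_set_basis (S : set U) :
  (forall W, is_subspace W -> S `<=` W -> W = [set: U]) ->
  exists (I : choiceType) (b : I -> U), is_basis b [set: U] /\ forall i, S (b i).
Proof.
move=> Sspan.
have [B [[BS Bind] Bmax]] : exists B, (B `<=` S /\ independent B) /\
    forall C, B `<` C -> ~ (C `<=` S /\ independent C).
  apply: (@Zorn_bigcup U [set B | B `<=` S /\ independent B]) => F FP Ftot; split.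
    by move=> u [X /FP[XS _] /XS].
  by apply: independent_bigcup => // X /FP[].
pose b (i : set_type B) := val i; exists (set_type B), b.
have Wsub := span_subspace b; split; last by move=> i; exact/BS/set_valP.
have BW : B `<=` [set lincomb b x | x in @finsupp K _].
  move=> u Bu; pose i : set_type B := SigSub (mem_set Bu).
  exists (fun j => (j == i)%:R); first exact: finsupp_delta.
  exact: lincomb_delta.
split; last exact: independent_basis.
apply: Sspan => // s Ss; apply: contrapT => nWs.
apply: (Bmax (s |` B)); last first.
  split; last exact: independent_setU1 Wsub BW nWs.
  by move=> u [->|/BS].
split; first by move=> u; right.
by move=> sB; apply/nWs/BW/sB; left.
Qed.

End ExtractBasis.

(** * Transversals and common eigenvectors *)

Section Eigenvectors.
Variable K : unitRingType.
Hypothesis K_field : forall x : K, x != 0 -> x \is a GRing.unit.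

Lemma proj_lineP (p : set (K^o * K^o)) :
  proj_line p <-> exists k l : K, (k != 0) || (l != 0) /\ p = kpt k l.
Proof.
split=> [/(is_pointP K_field)[[k l] kl0 ->]|[k [l [kl0 ->]]]].
  exists k, l; split=> //.
  by apply: contraNT kl0; rewrite negb_or !negbK => /andP[/eqP-> /eqP->].
apply/(is_pointP K_field); exists (k, l) => //.
by apply: contraTneq kl0 => -[-> ->]; rewrite eqxx.
Qed.

Variable U : lmodType K.

Definition eigenvector (rho : K -> {linear U -> U}) (beta : K -> K) (z : U) : Prop :=
  z != 0 /\ forall l, rho l z = beta l *: z.

(** The subspace Kz x Kz of U x U. *)
Definition tline (z : U) : set (U * U) :=
  [set w | exists a c, w = (a *: z, c *: z)].

Lemma tlineE z : tline z = span2 (z, 0) (0, z).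
Proof.
suff E a c : a *: ((z, 0) : U * U) + c *: (0, z) = (a *: z, c *: z).
  by apply/seteqP; split=> w [a [c ->]]; exists a, c; rewrite ?E.
by congr pair; rewrite /= scaler0 ?addr0 ?add0r.
Qed.

Lemma free2_tline z : z != 0 -> free2 ((z, 0) : U * U) (0, z).
Proof.
move=> z0 a c [/=]; rewrite !scaler0 addr0 add0r => az cz.
by split; apply: divring_scaler_eq0 z0.
Qed.

Lemma is_line_tline z : z != 0 -> is_line (tline z).
Proof.
by move=> z0; apply/is_lineP; exists (z, 0), (0, z); split;
  [exact: free2_tline | rewrite tlineE].
Qed.

Lemma tlineZ a z : a != 0 -> tline (a *: z) = tline z.
Proof.
move=> /K_field ua; apply/seteqP; split=> w [c [d ->]].
  by exists (c * a), (d * a); rewrite !scalerA.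
by exists (c * a^-1), (d * a^-1); rewrite !scalerA -!mulrA mulVr // !mulr1.
Qed.

Section Representation.
Variable rho : K -> {linear U -> U}.
Hypothesis rho_rep : is_representation rho.

Lemma rho0 u : rho 0 u = 0.
Proof.
have [_ rhoD _] := rho_rep.
by apply: (addrI (rho 0 u)); rewrite -rhoD !addr0.
Qed.

Lemma rhoKV k u : k != 0 -> rho k^-1 (rho k u) = u.
Proof. by have [rho1 _ rhoM] := rho_rep => /K_field uk; rewrite -rhoM mulrV. Qed.

Section Eigenvalue.
Variables (beta : K -> K) (z : U).
Hypothesis zE : eigenvector rho beta z.

(** The product [k * l] acts as [rho k] followed by [rho l], and linearity pulls [beta k] out of
    [rho l] to the left; hence [beta] preserves the order of products. *)
Lemma eigenvalueM k l : beta (k * l) = beta k * beta l.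
Proof.
have [_ _ rhoM] := rho_rep; have [z0 rz] := zE.
by apply: (divring_scalerI K_field z0); rewrite -rz rhoM rz linearZ rz /= scalerA.
Qed.

Lemma eigenvalueD k l : beta (k + l) = beta k + beta l.
Proof.
have [_ rhoD _] := rho_rep; have [z0 rz] := zE.
by apply: (divring_scalerI K_field z0); rewrite -rz rhoD !rz scalerDl.
Qed.

Lemma eigenvalue1 : beta 1 = 1.
Proof.
have [rho1 _ _] := rho_rep; have [z0 rz] := zE.
by apply: (divring_scalerI K_field z0); rewrite -rz rho1 scale1r.
Qed.

Lemma eigenvalue0 : beta 0 = 0.
Proof. by apply: (addrI (beta 0)); rewrite -eigenvalueD !addr0. Qed.

Lemma eigenvalue_eq0 k : (beta k == 0) = (k == 0).
Proof.
apply/eqP/eqP => [bk|->]; last exact: eigenvalue0.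
apply: contra_eq bk => /K_field uk; apply/eqP => bk.
by have /eqP := eigenvalueM k^-1 k; rewrite mulVr // eigenvalue1 bk mulr0 oner_eq0.
Qed.

Lemma eigenvalue_inj : injective beta.
Proof.
move=> k l kl; apply/eqP; rewrite -subr_eq0 -eigenvalue_eq0 eigenvalueD.
by rewrite kl -eigenvalueD subrr eigenvalue0.
Qed.

(** One of [k], [l] is nonzero, so the corresponding [rho] can be inverted; this forces any [u] with
    [(rho k u, rho l u)] on [tline z] to be a multiple of [z]. *)
Lemma tline_cap k l : (k != 0) || (l != 0) ->
  tline z `&` Phi rho (kpt k l) = [set a *: ((beta k *: z, beta l *: z) : U * U) | a in [set: K]].
Proof.
have [_ _ rhoM] := rho_rep; have [z0 rz] := zE.
move=> kl0; rewrite PhiE //; apply/seteqP; split=> w /=; last first.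
  move=> [a _ <-]; split; first by exists (a * beta k), (a * beta l); rewrite -!scalerA.
  by exists (a *: z) => //; rewrite !linearZ /= !rz.
move=> [[a [c ->]] [u _ [ku lu]]].
suff [d uE] : exists d, u = d *: z.
  by exists d => //; rewrite -ku -lu uE !linearZ /= !rz.
case/orP: kl0 => [k0|l0].
  by exists (a * beta k^-1); rewrite -(rhoKV u k0) ku linearZ /= rz scalerA.
by exists (c * beta l^-1); rewrite -(rhoKV u l0) lu linearZ /= rz scalerA.
Qed.

Lemma tline_cap_point k l : (k != 0) || (l != 0) ->
  is_point (tline z `&` Phi rho (kpt k l)).
Proof.
move=> kl0; rewrite tline_cap //; apply/(is_pointP K_field); eexists; last by [].
have [z0 _] := zE; apply: contraTneq kl0 => -[] kz lz.
have := divring_scaler_eq0 K_field kz z0; have := divring_scaler_eq0 K_field lz z0.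
by move=> /eqP + /eqP; rewrite !eigenvalue_eq0 => -> ->.
Qed.

(** Surjectivity of [beta] gives the covering condition: a point spanned by (a z, c z) lies on the
    member with parameters [k], [l] such that beta(k) = a and beta(l) = c. *)
Lemma transversal_tline : (forall c, exists l, beta l = c) -> transversal_line rho (tline z).
Proof.
have [z0 rz] := zE => surj; split; first exact: is_line_tline.
  move=> _ [_ /proj_lineP[k [l [kl0 ->]]] <-].
  exists (tline z `&` Phi rho (kpt k l)); split; first by split=> //; exact: tline_cap_point.
  by move=> P [ptP sP]; apply/esym/point_sub_eq => //; exact: tline_cap_point.
move=> P /(is_pointP K_field)[v v0 ->] sP.
have [a [c vE]] : tline z v by apply: sP; exists 1; rewrite ?scale1r.
have [k ka] := surj a; have [l lc] := surj c.
have kl0 : (k != 0) || (l != 0).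
  apply: contraNT v0; rewrite negb_or !negbK => /andP[/eqP k0 /eqP l0].
  by rewrite vE -ka -lc k0 l0 eigenvalue0 scale0r.
exists (Phi rho (kpt k l)); first by exists (kpt k l) => //; apply/proj_lineP; exists k, l.
by move=> w Pw; have [] : (tline z `&` Phi rho (kpt k l)) w
  by rewrite tline_cap // ka lc -vE.
Qed.

End Eigenvalue.

(** Three members of the family determine the shape Kz x Kz of [T], the members through (1, l) make
    [z] a common eigenvector, and the covering condition makes [beta] surjective. *)
Lemma transversal_eigenvector T : transversal_line rho T ->
  exists z beta, [/\ eigenvector rho beta z, forall c, exists l, beta l = c & T = tline z].
Proof.
have [rho1 rhoD rhoM] := rho_rep.
move=> [lineT meetT coverT].
have [v [w [vw TE]]] := proj1 (is_lineP T) lineT.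
have meet k l : (k != 0) || (l != 0) ->
    exists u, (rho k u, rho l u) != 0 /\ T (rho k u, rho l u).
  move=> kl0.
  have [|P [[/(is_pointP K_field)[y y0 PE] sP] _]] := meetT (Phi rho (kpt k l)).
    by exists (kpt k l) => //; apply/proj_lineP; exists k, l.
  have [Ty] : (T `&` Phi rho (kpt k l)) y by apply: sP; rewrite PE; exists 1; rewrite ?scale1r.
  by rewrite PhiE // => -[u _ uy]; exists u; rewrite uy.
(* The members for (1,0), (0,1) and (1,1) are U x 0, 0 x U and the diagonal. They supply points (x,
   0), (0, y) and (z, z) of [T]; the first two span [T], so [z] is a multiple of both [x] and
   [y]. *)
have [|x [x0 Tx]] := meet 1 0; first by rewrite oner_eq0.
have [|y [y0 Ty]] := meet 0 1; first by rewrite oner_eq0 orbT.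
have [|z [z0 Tz]] := meet 1 1; first by rewrite oner_eq0.
rewrite !rho1 !rho0 in x0 Tx y0 Ty z0 Tz.
have {}x0 : x != 0 by apply: contraNneq x0 => ->.
have {}y0 : y != 0 by apply: contraNneq y0 => ->.
have {}z0 : z != 0 by apply: contraNneq z0 => ->.
have xy : free2 ((x, 0) : U * U) (0, y).
  move=> a c [/=]; rewrite !scaler0 addr0 add0r => ax cy.
  by split; [exact: divring_scaler_eq0 ax x0 | exact: divring_scaler_eq0 cy y0].
have TE1 : T = span2 (x, 0) (0, y).
  by rewrite TE; apply: span2_exchange => //; rewrite -TE.
have [a [c [/=]]] : span2 (x, 0) (0, y) ((z, z) : U * U) by rewrite -TE1.
rewrite !scaler0 addr0 add0r => zx zy.
have TzE : T = tline z.
  rewrite TE1 tlineE; apply: span2_exchange => //; last exact: free2_tline.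
    by exists a, 0; rewrite scale0r addr0 zx; congr pair; rewrite scaler0.
  by exists 0, c; rewrite scale0r add0r zy; congr pair; rewrite scaler0.
(* A common vector (u, rho_l u) = (d z, e z) has d nonzero, whence rho_l z = d^-1 e z. *)
have eig l : exists d, rho l z = d *: z.
  have [|u [u0]] := meet 1 l; first by rewrite oner_eq0.
  rewrite TzE rho1 => -[d [e [ud le]]].
  have d0 : d != 0.
    apply: contraNneq u0 => d0; rewrite rho1 ud d0 scale0r; apply/eqP.
    by rewrite linear0.
  exists (d^-1 * e); rewrite -scalerA -le ud linearZ scalerA mulVr ?scale1r //.
  exact: K_field.
have [beta betaE] := choice eig.
have zE : eigenvector rho beta z by split.
exists z, beta; split=> // d.
(* To reach the value [d], the covering condition is applied to the point spanned by (z, d z). *)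
have Tzd : T (z, d *: z) by rewrite TzE; exists 1, d; rewrite scale1r.
pose P := [set e *: ((z, d *: z) : U * U) | e in [set: K]].
have ptP : is_point P.
  apply/(is_pointP K_field); exists (z, d *: z) => //.
  by apply: contraNneq z0 => -[-> _].
have PT : P `<=` T.
  by rewrite TzE => _ [e _ <-]; exists e, (e * d); rewrite -scalerA.
have [_ [p /proj_lineP[k [l [kl0 ->]]] <-] PS] := coverT P ptP PT.
have : (Phi rho (kpt k l)) (z, d *: z) by apply: PS; exists 1; rewrite ?scale1r.
rewrite PhiE // => -[u _ [ku lu]].
have k0 : k != 0 by apply: contraNneq z0 => k0; rewrite -ku k0 rho0.
(* From rho_k u = z and rho_l u = d z: acting by k^-1 takes [z] back to [u], and acting by [l] then
   yields d z. *)
exists (k^-1 * l); apply: (divring_scalerI K_field z0).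
by rewrite -betaE rhoM -{1}ku rhoKV.
Qed.

End Representation.
End Eigenvectors.

(** * The standard regulus as a projective representation *)

Section Regulus.
Variable K : unitRingType.
Hypothesis K_field : forall x : K, x != 0 -> x \is a GRing.unit.
Variable U : lmodType K.

(** In coordinates [rho k] is right multiplication by [alpha k], so the member at (k, l) is the
    regulus element at (alpha k, alpha l); a bijection fixing 0 only permutes the admissible
    pairs. *)
Lemma Phi_image_std_regulus (rho : K -> {linear U -> U}) (alpha : K -> K)
    (I : choiceType) (b : I -> U) :
  is_representation rho -> is_basis b [set: U] -> alpha 0 = 0 -> bijective alpha ->
  (forall k i, rho k (b i) = alpha k *: b i) -> Phi_image rho = std_regulus b.
Proof.
move=> rho_rep bE alpha0 [alphaV alphaK alphaVK] rhob.
have alpha_eq0 k : (alpha k == 0) = (k == 0).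
  by rewrite -{1}alpha0 (inj_eq (can_inj alphaK)).
have rhoE k x : finsupp x -> rho k (lincomb b x) = lincomb b (fun i => x i * alpha k).
  move=> fx; rewrite linear_lincomb //; apply: eq_fsbigr => i _ /=.
  by rewrite rhob scalerA.
have PhiE k l : Phi rho (kpt k l) =
    [set (lincomb b (fun i => x i * alpha k), lincomb b (fun i => x i * alpha l))
      | x in @finsupp K I].
  rewrite PhiE //; apply/seteqP; split=> w /= [].
    move=> u _ <-; exists (coords bE u); first exact: finsupp_coords.
    by rewrite -!rhoE ?lincomb_coords //; exact: finsupp_coords.
  by move=> x fx <-; exists (lincomb b x); rewrite // !rhoE.
apply/seteqP; split=> S.
  move=> [_ /(proj_lineP K_field)[k [l [kl0 ->]]] <-]; exists (alpha k), (alpha l).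
  by split; rewrite ?PhiE //; apply/(proj_lineP K_field); exists (alpha k), (alpha l);
    rewrite !alpha_eq0.
move=> [k [l [/(proj_lineP K_field) kl ->]]].
exists (kpt (alphaV k) (alphaV l)); last by rewrite PhiE !alphaVK.
apply/(proj_lineP K_field); exists (alphaV k), (alphaV l); split=> //.
rewrite -(alpha_eq0 (alphaV k)) -(alpha_eq0 (alphaV l)) !alphaVK.
(* The regulus only records that [kpt k l] is a point. Its nonzero generator (k', l') is a multiple
   of (k, l), which excludes k = l = 0. *)
have [k' [l' [kl0' /seteqP[_ sub]]]] := kl.
have [|a _ [k'E l'E]] := sub (k', l'); first by exists 1; rewrite ?mul1r.
apply: contraTT kl0'; rewrite !negb_or !negbK => /andP[/eqP k0 /eqP l0].
by rewrite -k'E -l'E k0 l0 !mulr0 eqxx.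
Qed.

Section ScaleBasis.
Variables (I : choiceType) (b : I -> U).
Hypothesis b_basis : is_basis b [set: U].

(** Coordinates are multiplied on the right, which commutes with left scalars; the map is therefore
    linear even for noncommutative [K], unlike u |-> l u. *)
Definition scale_basis (l : K) (u : U) : U := lincomb b (fun i => coords b_basis u i * l).

Lemma scale_basis_lincomb l x : finsupp x ->
  scale_basis l (lincomb b x) = lincomb b (fun i => x i * l).
Proof. by move=> fx; rewrite /scale_basis coordsK. Qed.

Lemma scale_basis_linear l : linear (scale_basis l).
Proof.
move=> a u v.
have [fu fv] := (finsupp_coords b_basis u, finsupp_coords b_basis v).
have faul := finsuppZ a (finsuppMr l fu); have fvl := finsuppMr l fv.
rewrite -{1}(lincomb_coords b_basis u) -{1}(lincomb_coords b_basis v).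
rewrite -lincombZ // -lincombD //; last exact: finsuppZ.
rewrite scale_basis_lincomb; last by apply: finsuppD => //; exact: finsuppZ.
rewrite /scale_basis -lincombZ -?lincombD //; last exact: finsuppMr.
by congr lincomb; apply: funext => i; rewrite mulrDl mulrA.
Qed.

HB.instance Definition _ l :=
  GRing.isLinear.Build K U U *:%R (scale_basis l) (scale_basis_linear l).

Lemma scale_basis_basis l i : scale_basis l (b i) = l *: b i.
Proof.
rewrite -[X in scale_basis l X](lincomb_delta b i) scale_basis_lincomb; last exact: finsupp_delta.
rewrite -[in RHS](lincomb_delta b i) -lincombZ; last exact: finsupp_delta.
by congr lincomb; apply: funext => j; case: (j == i); rewrite !(mul1r, mul0r, mulr1, mulr0).
Qed.

Lemma scale_basis_rep : is_representation (fun l => scale_basis l : {linear U -> U}).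
Proof.
split=> [u|k l u|k l u] /=; have fu := finsupp_coords b_basis u.
- by under [LHS]eq_fsbigr do rewrite mulr1; exact: lincomb_coords.
- rewrite /scale_basis -lincombD; [|exact: finsuppMr..].
  by congr lincomb; apply: funext => i; rewrite mulrDr.
- rewrite [in RHS]/scale_basis coordsK; last exact: finsuppMr.
  by congr lincomb; apply: funext => i; rewrite mulrA.
Qed.

(** A nonzero coordinate c of z satisfies c l = beta(l) c, so [beta] is conjugation by c and c^-1 z
    has the identity as eigenvalue map. *)
Lemma scale_basis_transversal T :
  transversal_line (fun l => scale_basis l : {linear U -> U}) T ->
  exists2 z, eigenvector (fun l => scale_basis l : {linear U -> U}) id z & T = tline z.
Proof.
move=> /(transversal_eigenvector K_field scale_basis_rep)[z [beta [[z0 zE] _ ->]]].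
have [i zi0] : exists i, coords b_basis z i != 0.
  apply: contrapT => /forallNP zi; move/eqP: z0; apply.
  rewrite -(lincomb_coords b_basis z) (@lincomb_seq _ _ _ _ _ [::]) ?big_nil //.
  by move=> i _; apply/eqP; move: (zi i) => /negP; rewrite negbK.
set c := coords b_basis z i in zi0 *; have uc := K_field zi0.
have cE l : c * l = beta l * c.
  have fz := finsupp_coords b_basis z.
  have := congr1 (fun u => coords b_basis u i) (zE l).
  rewrite /= coordsK; last exact: finsuppMr.
  rewrite -{2}(lincomb_coords b_basis z) -lincombZ // coordsK //; exact: finsuppZ.
have cV0 : c^-1 != 0 by rewrite invr_eq0.
exists (c^-1 *: z); last by rewrite tlineZ.
split=> [|l]; first exact: divring_scaler_neq0.
rewrite linearZ zE /= !scalerA; congr (_ *: _).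
by rewrite -[LHS]mulr1 -(mulrV uc) !mulrA -(mulrA _ _ c) -cE mulrA mulVr // mul1r.
Qed.

End ScaleBasis.
End Regulus.

(** * Images under linear bijections *)

Section Transport.
Variable K : unitRingType.
Hypothesis K_field : forall x : K, x != 0 -> x \is a GRing.unit.
Variables (V W : lmodType K) (g : {linear V -> W}) (h : W -> V).
Hypotheses (gK : cancel g h) (hK : cancel h g).

Lemma image_point (P : set V) : is_point P -> is_point (g @` P).
Proof.
move=> /(is_pointP K_field)[v v0 ->]; apply/(is_pointP K_field); exists (g v).
  by rewrite -(linear0 g) (inj_eq (can_inj gK)).
apply/seteqP; split=> w /= [].
  by move=> _ [a _ <-] <-; exists a; rewrite ?linearZ.
by move=> a _ <-; exists (a *: v); rewrite ?linearZ //; exists a.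
Qed.

Lemma image_line (T : set V) : is_line T -> is_line (g @` T).
Proof.
move=> /is_lineP[v [w [vw ->]]]; apply/is_lineP; exists (g v), (g w); split.
  move=> a c; rewrite -!linearZ -linearD -(linear0 g) => /(can_inj gK); exact: vw.
apply/seteqP; split=> u /=.
  by move=> [_ [a [c ->]] <-]; exists a, c; rewrite linearD !linearZ.
by move=> [a [c ->]]; exists (a *: v + c *: w); [exists a, c | rewrite linearD !linearZ].
Qed.

Lemma image_cap (A B : set V) : g @` (A `&` B) = g @` A `&` g @` B.
Proof.
apply/seteqP; split=> w /=; first by move=> [v [Av Bv] <-]; split; exists v.
by move=> [[v Av <-] [v' Bv' /(can_inj gK) vv']]; exists v; split; rewrite // -vv'.
Qed.

End Transport.

(* [transversal_line rho] depends on [rho] only through [Phi_image rho]. *)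
Definition transversal_of (K : unitRingType) (V : lmodType K) (R : set (set V))
    (T : set V) : Prop :=
  [/\ is_line T,
      forall S, R S -> exists! P, is_point P /\ P `<=` T `&` S &
      forall P, is_point P -> P `<=` T -> exists2 S, R S & P `<=` S].

Lemma transversal_image (K : unitRingType)
    (K_field : forall x : K, x != 0 -> x \is a GRing.unit) (V W : lmodType K)
    (g : {linear V -> W}) (h : {linear W -> V}) (R : set (set V)) (T : set V) :
  cancel g h -> cancel h g -> transversal_of R T ->
  transversal_of [set g @` S | S in R] (g @` T).
Proof.
move=> gK hK [lineT meetT coverT]; split; first exact: image_line gK _ lineT.
  move=> _ [S RS <-]; have [P [[ptP sP] uP]] := meetT S RS.
  exists (g @` P); split.
    by rewrite -(image_cap gK); split; [exact: image_point gK _ ptP | exact: image_subset].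
  (* Uniqueness is pulled back: h(Q) is a point of both [T] and [S], hence equals [P]. *)
  move=> Q [ptQ sQ]; rewrite (uP (h @` Q)) ?image_comp; last first.
    split; first exact: image_point hK _ ptQ.
    by move=> _ [q /sQ + <-]; rewrite -(image_cap gK) => -[v Tv <-]; rewrite gK.
  by rewrite (_ : g \o h = id) ?image_id //; apply: funext.
move=> P ptP sP; have [|v|S RS sS] := coverT (h @` P); first exact: image_point hK _ ptP.
  by move=> [q /sP[t Tt <-] <-]; rewrite gK.
exists (g @` S); first by exists S.
by move=> q Pq; exists (h q); [apply: sS; exists q | rewrite hK].
Qed.

(** * Projectively linked transversals *)

Section Linked.
Variable K : unitRingType.
Hypothesis K_field : forall x : K, x != 0 -> x \is a GRing.unit.
Variables (U : lmodType K) (rho : K -> {linear U -> U}).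
Hypothesis rho_rep : is_representation rho.

(** The linking map sends (z1, 0) to (a z2, 0) and (0, z1) to (0, d z2). The point at (1, l) then
    gives beta1(l) d = a beta2(l), and l = 1 gives d = a, so a z2 has eigenvalue map [beta1]. *)
Lemma linked_eigenvalues z1 z2 beta1 beta2 :
  eigenvector rho beta1 z1 -> eigenvector rho beta2 z2 ->
  projectively_linked rho (tline z1) (tline z2) ->
  exists2 c, c != 0 & eigenvector rho beta1 (c *: z2).
Proof.
move=> z1E z2E [f [[_ finj _] flin] flink].
have [z10 rz1] := z1E; have [z20 rz2] := z2E.
have fP k l : (k != 0) || (l != 0) ->
    exists a, f (beta1 k *: z1, beta1 l *: z1) = ((a * beta2 k) *: z2, (a * beta2 l) *: z2).
  move=> kl0.
  have : (tline z2 `&` Phi rho (kpt k l)) (f (beta1 k *: z1, beta1 l *: z1)).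
    rewrite -(flink (tline z1 `&` Phi rho (kpt k l)) (tline z2 `&` Phi rho (kpt k l))); last first.
      by exists (kpt k l) => //; apply/(proj_lineP K_field); exists k, l.
    exists (beta1 k *: z1, beta1 l *: z1) => //.
    by rewrite (tline_cap K_field rho_rep z1E) //; exists 1; rewrite ?scale1r.
  rewrite (tline_cap K_field rho_rep z2E) // => -[a _ <-].
  by exists a; rewrite -!scalerA.
have [beta1_1 beta1_0] := (eigenvalue1 K_field rho_rep z1E, eigenvalue0 K_field rho_rep z1E).
have [beta2_1 beta2_0] := (eigenvalue1 K_field rho_rep z2E, eigenvalue0 K_field rho_rep z2E).
have [|a] := fP 1 0; first by rewrite oner_eq0.
have [|d] := fP 0 1; first by rewrite oner_eq0 orbT.
rewrite beta1_1 beta1_0 beta2_1 beta2_0 !mulr1 !mulr0 !scale0r scale1r => f01 f10.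
have in10 : tline z1 (z1, 0) by exists 1, 0; rewrite scale1r scale0r.
have in01 : tline z1 (0, z1) by exists 0, 1; rewrite scale1r scale0r.
have f1 c : f (z1, c *: z1) = (a *: z2, (c * d) *: z2).
  rewrite (_ : (z1, c *: z1) = c *: ((0, z1) : U * U) + (z1, 0)); last first.
    by congr pair; rewrite /= ?scaler0 ?addr0 ?add0r.
  by rewrite flin // f01 f10; congr pair; rewrite /= ?scaler0 ?addr0 ?add0r // scalerA.
have f1l l : beta1 l * d = a * beta2 l.
  have [|e] := fP 1 l; first by rewrite oner_eq0.
  rewrite beta1_1 beta2_1 scale1r mulr1 f1 => -[/(divring_scalerI K_field z20) ->].
  exact: divring_scalerI.
have ad : d = a by have := f1l 1; rewrite beta1_1 beta2_1 mul1r mulr1.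
have a0 : a != 0.
  (* If a = d = 0, then [f] takes the same value at (z1, z1) and (z1, 0), so injectivity gives z1 =
     0. *)
  apply: contraNneq z10 => a0.
  have /(congr1 snd) /= : (z1, 1 *: z1) = (z1, 0) :> U * U.
    apply: finj; rewrite ?inE //; first by exists 1, 1; rewrite !scale1r.
    by rewrite f1 f10 ad a0 mulr0 scale0r.
  by rewrite scale1r => ->.
exists a => //; split=> [|l]; first exact: divring_scaler_neq0.
by rewrite linearZ /= rz2 !scalerA -f1l ad.
Qed.

End Linked.

(** * Linked transversals, scalar bases and reguli *)

Lemma field_rmorphism (K : unitRingType) (beta : K -> K) :
  (forall k l, beta (k + l) = beta k + beta l) -> beta 1 = 1 ->
  (forall k l, beta (k * l) = beta k * beta l) ->
  exists alpha : {rmorphism K -> K}, alpha =1 beta.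
Proof.
move=> bD b1 bM.
have b0 : beta 0 = 0 by apply: (addrI (beta 0)); rewrite -bD !addr0.
have bB : {morph beta : k l / k - l}.
  by move=> k l; apply: (addIr (beta l)); rewrite -bD !subrK.
pose zM := GRing.isZmodMorphism.Build K K beta bB.
pose mM := GRing.isMonoidMorphism.Build K K beta (conj b1 bM).
pose alpha : {rmorphism K -> K} := HB.pack beta zM mM.
by exists alpha.
Qed.

Section Equivalence.
Variable K : unitRingType.
Hypothesis K_field : forall x : K, x != 0 -> x \is a GRing.unit.
Variable U : lmodType K.
Hypothesis U_neq0 : exists u : U, u != 0.
Variable rho : K -> {linear U -> U}.
Hypothesis rho_rep : is_representation rho.

Lemma scalar_basis_regulus (I : choiceType) (b : I -> U) (alpha : {rmorphism K -> K}) :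
  is_basis b [set: U] -> bijective alpha -> (forall k i, rho k (b i) = alpha k *: b i) ->
  is_regulus (Phi_image rho).
Proof.
move=> bE alpha_bij rhob; exists I, b; split=> //.
exists idfun; split; first by exists idfun.
rewrite (Phi_image_std_regulus K_field rho_rep bE (rmorph0 alpha) alpha_bij rhob).
apply/seteqP; split=> S; first by move=> RS; exists S; rewrite ?image_id.
by move=> [S' RS' <-]; rewrite image_id.
Qed.

Lemma linked_scalar_basis :
  (forall T1 T2, transversal_line rho T1 -> transversal_line rho T2 ->
     projectively_linked rho T1 T2) ->
  generated_subspace (\bigcup_(T in [set T | transversal_line rho T]) T) = [set: U * U] ->
  exists (I : choiceType) (b : I -> U) (alpha : {rmorphism K -> K}),
    [/\ is_basis b [set: U], bijective alpha & forall k i, rho k (b i) = alpha k *: b i].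
Proof.
move=> linked gen.
(* Without transversals the generated subspace would be 0, whereas [U] is nonzero. *)
have [T0 T0t] : exists T, transversal_line rho T.
  apply: contrapT => /forallNP noT; have [u /eqP u0] := U_neq0; apply: u0.
  have : [set: U * U] (u, 0) by [].
  rewrite -gen => u_gen; suff /(congr1 fst) : [set 0] ((u, 0) : U * U) by [].
  apply: u_gen.
  split; first by apply/subspaceP; split=> // a v w -> ->; rewrite scaler0 addr0.
  by move=> v [T /noT].
have [z0 [beta [z0E surj T0E]]] := transversal_eigenvector K_field rho_rep T0t.
have [|I [b [bE Sb]]] := @spanning_set_basis K K_field U
    [set z | forall l, rho l z = beta l *: z].
  move=> W Wsub SW; apply/seteqP; split=> // u _.
  (* W x W is a subspace of U x U; once it contains all transversals it is everything, so W = U. *)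
  suff [] : [set w : U * U | W w.1 /\ W w.2] (u, u) by [].
  have : [set: U * U] (u, u) by [].
  rewrite -gen => /(_ [set w : U * U | W w.1 /\ W w.2]); apply; split.
    have [W0 Wl] := proj1 (subspaceP W) Wsub.
    apply/subspaceP; split=> // a v w [v1 v2] [w1 w2].
    by split; apply: Wl.
  move=> v [T Tt Tv]; have [z [beta' [zE _ TE]]] := transversal_eigenvector K_field rho_rep Tt.
  (* Linking with the fixed transversal [T0] rescales [z] to a vector with eigenvalue map [beta],
     without changing its line. *)
  have [|c c0 [_ czE]] := linked_eigenvalues K_field rho_rep z0E zE.
    by rewrite -T0E -TE; exact: linked.
  have Wcz := SW _ czE.
  by move: Tv; rewrite TE -(tlineZ K_field z c0) => -[a [d ->]]; split; exact: subspaceZ.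
have [alpha alphaE] := field_rmorphism (eigenvalueD K_field rho_rep z0E)
  (eigenvalue1 K_field rho_rep z0E) (eigenvalueM K_field rho_rep z0E).
exists I, b, alpha; split=> // [|k i]; last by rewrite alphaE; exact: Sb.
have [betaV betaVK] := choice surj.
exists betaV => k; last by rewrite alphaE.
by apply: (eigenvalue_inj K_field rho_rep z0E); rewrite betaVK alphaE.
Qed.

End Equivalence.

(** * Transversals of an arbitrary regulus *)

Section RegulusLinked.
Variable K : unitRingType.
Hypothesis K_field : forall x : K, x != 0 -> x \is a GRing.unit.
Variable U : lmodType K.
Variable rho : K -> {linear U -> U}.
Variables (I : choiceType) (b : I -> U).
Hypothesis b_basis : is_basis b [set: U].
Variables (g h : {linear (U * U)%type -> (U * U)%type}).
Hypotheses (gK : cancel g h) (hK : cancel h g).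
Let sigma l : {linear U -> U} := scale_basis b_basis l.
Hypothesis rhoE : Phi_image rho = [set g @` S | S in Phi_image sigma].

Lemma regulus_transversal T : transversal_line rho T ->
  exists2 z, eigenvector sigma id z & T = g @` tline z.
Proof.
move=> Tt.
have /(transversal_image K_field hK gK) : transversal_of (Phi_image rho) T by [].
rewrite rhoE image_comp (_ : _ \o _ = id) ?image_id; last first.
  by apply: funext => S /=; rewrite image_comp (_ : h \o g = id) ?image_id //; exact: funext.
move=> /(scale_basis_transversal K_field)[z zE TE]; exists z => //.
by rewrite -TE image_comp (_ : g \o h = id) ?image_id //; exact: funext.
Qed.

Lemma regulus_linked T1 T2 : transversal_line rho T1 -> transversal_line rho T2 ->
  projectively_linked rho T1 T2.
Proof.
move=> /regulus_transversal[z1 z1E ->] /regulus_transversal[z2 z2E ->].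
have [[z10 _] [z20 _]] := (z1E, z2E).
(* [phi] reads off the coefficient of a multiple of [z1] and defaults to 0 elsewhere; the linking
   map must be a total function, but is linear only on the transversal. *)
have [phi phiE] : {phi : U -> K | forall a, phi (a *: z1) = a}.
  exists (fun u => xget 0 [set a | u = a *: z1]) => a.
  case: xgetP => [c _ /=|/(_ a) /(_ erefl) //].
  by move=> /(divring_scalerI K_field z10).
pose f w := g (phi (h w).1 *: z2, phi (h w).2 *: z2).
have fE a c : f (g (a *: z1, c *: z1)) = g (a *: z2, c *: z2).
  by rewrite /f gK /= !phiE.
exists f.
  split.
    split=> [_ [_ [a [c ->]] <-]|v w|_ [_ [a [c ->]] <-]].
    - by rewrite fE; exists (a *: z2, c *: z2) => //; exists a, c.
    - rewrite !inE => -[_ [a [c ->]] <-] [_ [a' [c' ->]] <-].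
      rewrite !fE => /(can_inj gK)[/(divring_scalerI K_field z20) ->].
      by move/(divring_scalerI K_field z20) ->.
    - by exists (g (a *: z1, c *: z1)) => //; exists (a *: z1, c *: z1) => //; exists a, c.
  move=> d _ _ [_ [a [c ->]] <-] [_ [a' [c' ->]] <-].
  rewrite -linearP (_ : d *: _ + _ = ((d * a + a') *: z1, (d * c + c') *: z1)); last first.
    by congr pair; rewrite /= scalerDl scalerA.
  rewrite !fE -linearP; congr (g _).
  by congr pair; rewrite /= scalerDl scalerA.
move=> P Q [p pp [-> ->]].
(* The member at [p] is the image under [g] of a [sigma]-member whose parameter [q] may differ from
   [p]; the same [q] serves both transversals, which suffices. *)
have [_ [q /(proj_lineP K_field)[k [l [kl0 ->]]] <-] <-] :
    [set g @` S | S in Phi_image sigma] (Phi rho p) by rewrite -rhoE; exists p.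
have sigma_rep : is_representation sigma by exact: scale_basis_rep.
rewrite -!(image_cap gK) (tline_cap K_field sigma_rep z1E kl0).
rewrite (tline_cap K_field sigma_rep z2E kl0).
have E a u : a *: ((k *: u, l *: u) : U * U) = ((a * k) *: u, (a * l) *: u).
  by congr pair; rewrite /= scalerA.
apply/seteqP; split=> w /=.
  move=> [_ [_ [a _ <-] <-] <-]; exists (a *: (k *: z2, l *: z2)); first by exists a.
  by rewrite !E fE.
move=> [_ [a _ <-] <-]; exists (g (a *: (k *: z1, l *: z1))); last by rewrite !E fE.
by exists (a *: (k *: z1, l *: z1)) => //; exists a.
Qed.

(** Each basis vector gives the transversal g(K b_i x K b_i), and expanding u and v over a common
    finite list writes g(u, v) as a sum of vectors on these lines. *)
Lemma regulus_generated :
  generated_subspace (\bigcup_(T in [set T | transversal_line rho T]) T) = [set: U * U].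
Proof.
apply/seteqP; split=> // w _ M [/subspaceP[M0 Ml] MT].
have Mb i a c : M (g (a *: b i, c *: b i)).
  apply: MT; exists (g @` tline (b i)); last by exists (a *: b i, c *: b i) => //; exists a, c.
  suff : transversal_of (Phi_image rho) (g @` tline (b i)) by [].
  rewrite rhoE; apply: (transversal_image K_field gK hK).
  apply: (transversal_tline K_field (scale_basis_rep b_basis) (beta := id));
    last by move=> c'; exists c'.
  split; last by move=> l; exact: scale_basis_basis.
  apply/eqP => bi0; have := proj2 b_basis _ (finsupp_delta K i).
  by rewrite lincomb_delta => /(_ bi0 i)/eqP; rewrite eqxx oner_eq0.
rewrite -(hK w); case: (h w) => u v.
have [r [ur rx ry]] := finsupp2 (finsupp_coords b_basis u) (finsupp_coords b_basis v).
rewrite -(lincomb_coords b_basis u) -(lincomb_coords b_basis v).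
rewrite !(lincomb_seq _ ur) //; elim: {ur rx ry} r => [|i r IH].
  by rewrite !big_nil linear0.
rewrite !big_cons; set u' := \sum_(_ <- r) _ in IH *; set v' := \sum_(_ <- r) _ in IH *.
have := Ml 1 _ _ (Mb i (coords b_basis u i) (coords b_basis v i)) IH.
by rewrite scale1r -linearD.
Qed.

End RegulusLinked.

Theorem theorem3p1 (K : unitRingType) (K_field : forall x : K, x != 0 -> x \is a GRing.unit)
    (U : lmodType K) (U_neq0 : exists u : U, u != 0)
    (rho : K -> {linear U -> U}) (rho_rep : is_representation rho) :
  [<-> is_regulus (Phi_image rho);
       (forall T1 T2, transversal_line rho T1 -> transversal_line rho T2 ->
          projectively_linked rho T1 T2) /\
       generated_subspace (\bigcup_(T in [set T | transversal_line rho T]) T) = [set: U * U];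
       exists (I : choiceType) (b : I -> U) (alpha : {rmorphism K -> K}),
         [/\ is_basis b [set: U], bijective alpha &
             forall k i, rho k (b i) = alpha k *: b i]].
Proof.
tfae.
- move=> [I [b [bE [g [[h gK hK] RE]]]]].
  (* The inverse of a linear bijection is linear; it is bundled so that transversals can be pulled
     back along it. *)
  pose hL := GRing.isLinear.Build K _ _ *:%R h (can2_linear gK hK).
  pose h' : {linear (U * U)%type -> (U * U)%type} := HB.pack h hL.
  have sigmaE : Phi_image (fun l => scale_basis bE l : {linear U -> U}) = std_regulus b.
    apply: (Phi_image_std_regulus K_field (scale_basis_rep bE) bE (alpha := id)) => //.
      by exists id.
    exact: scale_basis_basis.
  rewrite -sigmaE in RE; split.
    by move=> T1 T2; exact: (regulus_linked K_field (h := h') gK hK RE).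
  exact: (regulus_generated K_field (h := h') gK hK RE).
- by move=> [linked gen]; exact: linked_scalar_basis.
- by move=> [I [b [alpha [bE alpha_bij rhob]]]]; exact: scalar_basis_regulus bE alpha_bij rhob.
Qed.
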